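(* For a hypergraph $H$ and a subset $B\subseteq V(H)$, $B$ is a lazy burning set for $H$ if and only if $B\cup E(H)$ is a zero forcing set for $\mathrm{IG}(H)$.
   Context: A hypergraph $H$ consists of a finite vertex set $V(H)$ and a finite collection $E(H)$ of nonempty subsets of $V(H)$. Lazy burning: a set $B\subseteq V(H)$ is burned initially; in each subsequent round every unburned vertex $v$ for which some hyperedge $h\ni v$ has $h\setminus\{v\}$ entirely burned becomes burned. $B$ is a lazy burning set if eventually all vertices burn. The incidence graph $\mathrm{IG}(H)$ is the bipartite graph on $V(H)\cup E(H)$ with $v\in V(H)$ adjacent to $h\in E(H)$ iff $v\in h$. Zero forcing on a graph $G$: an initial set of vertices is black, the rest white; repeatedly, a black vertex $u$ with exactly one white neighbor $w$ turns $w$ black. A zero forcing set is an initial black set from which all vertices eventually become black. *)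

(* Defs.v *)
From mathcomp Require Import all_boot.

Set Implicit Arguments.
Unset Strict Implicit.
Unset Printing Implicit Defensive.

(* The hyperedges form a finite family of nonempty vertex sets: [edge H] indexes
   them and [members h] is the vertex set of [h].  The collection is a set when
   [members] is injective; repeated hyperedges are allowed, and there may be no
   vertices or no hyperedges. *)
Record hypergraph := Hypergraph {
  vertex : finType;
  edge : finType;
  members : edge -> {set vertex};
  members_neq0 : forall h : edge, members h != set0
}.

(* A singleton hyperedge burns its vertex in the first round, because
   [members h :\ v] is then empty. *)
Definition burn_round (H : hypergraph) (A : {set vertex H}) : {set vertex H} :=
  A :|: [set v | (v \notin A)
                 && [exists h : edge H,
                       (v \in members h) && (members h :\ v \subset A)]].

Definition lazy_burning_set (H : hypergraph) (B : {set vertex H}) : Prop :=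
  exists n : nat, iter n (@burn_round H) B = [set: vertex H].

Record graph := Graph {
  node : finType;
  adj : rel node;
  adj_sym : symmetric adj;
  adj_irrefl : irreflexive adj
}.

Definition white_neighbors (G : graph) (Z : {set node G}) (u : node G) :
    {set node G} :=
  [set w | adj u w && (w \notin Z)].

Definition force (G : graph) : rel {set node G} :=
  fun Z Z' => [exists u : node G, exists w : node G,
    [&& u \in Z, white_neighbors Z u == [set w] & Z' == w |: Z]].

(* Forces are performed one at a time.  Their order is immaterial, since a force
   that is available stays available until its target is black. *)
Definition zero_forcing_set (G : graph) (Z : {set node G}) : Prop :=
  connect (@force G) Z [set: node G].

Definition incidence_rel (H : hypergraph) : rel (vertex H + edge H) :=
  fun x y => match x, y with
             | inl v, inr h | inr h, inl v => v \in members h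
             | _, _ => false
             end.

Lemma incidence_sym (H : hypergraph) : symmetric (@incidence_rel H).
Proof. by case=> [v|h] [w|k]. Qed.

Lemma incidence_irrefl (H : hypergraph) : irreflexive (@incidence_rel H).
Proof. by case. Qed.

Definition incidence_graph (H : hypergraph) : graph :=
  Graph (@incidence_sym H) (@incidence_irrefl H).

Definition with_all_edges (H : hypergraph) (B : {set vertex H}) :
    {set node (incidence_graph H)} :=
  [set inl v | v in B] :|: [set inr h | h in [set: edge H]].

(* Main.v *)
(* Since all hyperedges of [H] start black, only a hyperedge [h] can force, and it
   forces a vertex [v] exactly when [h :\ v] is black.  So a force adds a single
   vertex that a burning round from the same vertex set would burn, and a burning
   round is a sequence of forces. *)
Require Import Defs.
From mathcomp Require Import all_boot.

Lemma mem_burn_round (H : hypergraph) (A : {set vertex H}) (v : vertex H) :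
  (v \in burn_round A) =
  (v \in A) || [exists h : edge H, (v \in members h) && (members h :\ v \subset A)].
Proof. by rewrite !inE; case: (v \in A). Qed.

(** In the form of [mem_burn_round], a hyperedge that witnesses [v] for [A] still does for [C]. So a
    vertex that can burn stays burnable while others are added. *)
Lemma burn_roundS (H : hypergraph) (A C : {set vertex H}) :
  A \subset C -> burn_round A \subset burn_round C.
Proof.
move=> sAC; apply/subsetP => v; rewrite !mem_burn_round.
case/orP => [vA | /existsP[h /andP[vh shA]]]; first by rewrite (subsetP sAC).
by apply/orP; right; apply/existsP; exists h; rewrite vh (subset_trans shA).
Qed.

Lemma iter_burn_roundS (H : hypergraph) (n : nat) (A C : {set vertex H}) :
  A \subset C -> iter n (@burn_round H) A \subset iter n (@burn_round H) C.
Proof. by elim: n => //= n IHn sAC; apply/burn_roundS/IHn. Qed.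

Lemma inl_with_all_edges (H : hypergraph) (A : {set vertex H}) (v : vertex H) :
  (inl v \in with_all_edges A) = (v \in A).
Proof.
rewrite inE orbC; case: imsetP => [[] //|_] /=.
by rewrite mem_imset // => x y [].
Qed.

Lemma inr_with_all_edges (H : hypergraph) (A : {set vertex H}) (h : edge H) :
  inr h \in with_all_edges A.
Proof. by rewrite inE orbC imset_f. Qed.

Lemma with_all_edgesU1 (H : hypergraph) (A : {set vertex H}) (v : vertex H) :
  with_all_edges (v |: A) = inl v |: with_all_edges A.
Proof.
apply/setP => -[x|h]; rewrite in_setU1 ?inr_with_all_edges ?orbT //.
by rewrite !inl_with_all_edges in_setU1.
Qed.

Lemma with_all_edges_eqT (H : hypergraph) (A : {set vertex H}) :
  with_all_edges A = [set: _] <-> A = [set: _].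
Proof.
split=> [eT | ->]; apply/setP => x.
  by rewrite -inl_with_all_edges eT !inE.
by case: x => x; rewrite ?inr_with_all_edges ?inl_with_all_edges !inE.
Qed.

Lemma force_with_all_edgesP (H : hypergraph) (A : {set vertex H})
    (Z : {set node (incidence_graph H)}) :
  reflect (exists2 v, v \in burn_round A :\: A & Z = with_all_edges (v |: A))
          (force (with_all_edges A) Z).
Proof.
apply: (iffP existsP) => [[u /existsP[w /and3P[_ /eqP eN /eqP ->]]] | [v]].
  have: w \in white_neighbors (with_all_edges A) u by rewrite eN set11.
  rewrite inE => /andP[].
  (* Nodes of the same kind are not adjacent and a hyperedge is never white, so the forcing node is
     a hyperedge [h] and its target a vertex [v]. *)
  case: w u eN => [v|k] [x|h] //= eN; rewrite ?inr_with_all_edges //.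
  rewrite inl_with_all_edges => vh vA.
  exists v; last by rewrite with_all_edgesU1.
  rewrite inE vA mem_burn_round; apply/orP; right; apply/existsP; exists h.
  rewrite vh; apply/subsetP => x; rewrite !inE => /andP[xv xh].
  (* A member [x] of [h] outside [A] is a white neighbor of [h], hence equals the unique one,
     [v]. *)
  apply: contraR xv => xA.
  have: inl x \in white_neighbors (with_all_edges A) (inr h).
    by rewrite inE inl_with_all_edges xA andbT.
  by rewrite eN inE => /eqP[->].
rewrite inE mem_burn_round => /andP[vA]; rewrite (negPf vA) /=.
case/existsP => h /andP[vh shA] ->.
exists (inr h); apply/existsP; exists (inl v).
rewrite inr_with_all_edges with_all_edgesU1 eqxx andbT /=.
apply/eqP/setP => -[x|k]; rewrite !inE //=.
rewrite -in_setU inl_with_all_edges.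
apply/andP/eqP => [[xh xA] | [->] //].
(* A member of [h] other than [v] lies in [members h :\ v], hence is black. *)
apply: contraNeq xA => nxv; apply: (subsetP shA); rewrite !inE xh andbT.
by apply: contraNneq nxv => ->.
Qed.

Lemma connect_force_burn_round (H : hypergraph) (A : {set vertex H}) :
  connect (@force (incidence_graph H)) (with_all_edges A)
    (with_all_edges (burn_round A)).
Proof.
have sA : A \subset burn_round A by apply: subsetUl.
(* The vertices of the round are forced one by one along a list; [C] is the current black vertex
   set. Since it contains [A], monotonicity keeps the rest of the list forceable. *)
have step (s : seq (vertex H)) (C : {set vertex H}) :
    A \subset C -> {subset s <= burn_round A} ->
    connect (@force (incidence_graph H)) (with_all_edges C)
      (with_all_edges (C :|: [set x in s])).
  elim: s C => [|v s IHs] C sAC ss; first by rewrite set_nil setU0.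
  rewrite set_cons setUA (setUC C); apply: connect_trans (IHs _ _ _); first last.
  - by move=> x xs; apply: ss; rewrite inE xs orbT.
  - exact: subset_trans sAC (subsetUr _ _).
  (* The list may meet vertices that are already black; these take no force. *)
  have [vC | vC] := boolP (v \in C); first by rewrite (setUidPr _) // sub1set.
  apply/connect1/force_with_all_edgesP; exists v => //.
  by rewrite inE vC (subsetP (burn_roundS _ _ _ sAC)) // ss ?mem_head.
have := step (enum (burn_round A)) A (subxx A).
rewrite set_enum (setUidPr sA); apply => x; by rewrite mem_enum.
Qed.

Theorem theorem4p1 (H : hypergraph) (B : {set vertex H}) :
  lazy_burning_set B <-> zero_forcing_set (with_all_edges B).
Proof.
split=> [[n eT] | /connectP[p]].
  rewrite /zero_forcing_set -((with_all_edges_eqT _ _).2 eT).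
  elim: n {eT} => [|n IHn] /=; first exact: connect0.
  exact: connect_trans IHn (connect_force_burn_round _ _).
(* Induction on the sequence of forces, charging one full round to each force. *)
elim: p B => [|Z p IHp] B /=.
  by move=> _ /esym/with_all_edges_eqT eT; exists 0.
case/andP => /force_with_all_edgesP[v + ->] => /setDP[vB _] pZ lZ.
have [n eT] := IHp _ pZ lZ; exists n.+1.
(* The first round from [B] already covers [v |: B], and the [n] remaining rounds are monotone. *)
apply/eqP; rewrite -subTset -eT iterSr iter_burn_roundS //.
by rewrite subUset sub1set vB subsetUl.
Qed.
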